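(* Let $(X,r)$ be a finite uniconnected solution. Then its Dehornoy's class $d$ satisfies $d\leq |X|$.
   Context: A solution is a pair $(X,r)$ with $X$ a non-empty set and $r:X\times X\to X\times X$, $r(x,y)=(\sigma_x(y),\tau_y(x))$, such that $(r\times \mathrm{id})(\mathrm{id}\times r)(r\times \mathrm{id})=(\mathrm{id}\times r)(r\times \mathrm{id})(\mathrm{id}\times r)$ on $X^3$, $r^2=\mathrm{id}$ (involutive), and all maps $\sigma_x,\tau_y:X\to X$ are bijections (non-degenerate). The permutation group $\mathcal{G}(X,r)$ is the subgroup of $\mathrm{Sym}(X)$ generated by all $\sigma_x$. $(X,r)$ is uniconnected if $\mathcal{G}(X,r)$ acts regularly on $X$. Dehornoy's class: set $x\cdot y=\sigma_x^{-1}(y)$ and define $\Omega_n:X^n\to X$ by $\Omega_1(x_1)=x_1$ and $\Omega_n(x_1,\dots,x_n)=\Omega_{n-1}(x_1,\dots,x_{n-1})\cdot\Omega_{n-1}(x_1,\dots,x_{n-2},x_n)$ for $n>1$. The Dehornoy's class of $(X,r)$ is the minimal positive integer $d$ such that $\Omega_{d+1}(x,x,\dots,x,y)=y$ for all $x,y\in X$. *)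

(* Defs.v *)
From mathcomp Require Import all_boot all_fingroup.

Set Implicit Arguments.
Unset Strict Implicit.
Unset Printing Implicit Defensive.

Section YangBaxterMaps.

Variables (X : Type) (r : X * X -> X * X).

Definition rxid (t : X * X * X) : X * X * X :=
  let: (x, y, z) := t in (r (x, y), z).

Definition idxr (t : X * X * X) : X * X * X :=
  let: (x, y, z) := t in (x, (r (y, z)).1, (r (y, z)).2).

Definition braid_equation : Prop :=
  rxid \o idxr \o rxid =1 idxr \o rxid \o idxr.

Definition sigma (x y : X) : X := (r (x, y)).1.

Definition tau (y x : X) : X := (r (x, y)).2.

Definition nondegenerate : Prop :=
  (forall x, bijective (sigma x)) /\ (forall y, bijective (tau y)).

End YangBaxterMaps.

Record solution (X : finType) := Solution {
  sol_map :> X * X -> X * X;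
  sol_nonempty : 0 < #|X|;
  sol_braid : braid_equation sol_map;
  sol_involutive : involutive sol_map;
  sol_nondegenerate : nondegenerate sol_map
}.

Section Solutions.

Variables (X : finType) (r : solution X).

Definition sigma_perm (x : X) : {perm X} :=
  perm (bij_inj ((sol_nondegenerate r).1 x)).

Definition permutation_group : {group {perm X}} :=
  <<[set sigma_perm x | x : X]>>%G.

Definition uniconnected : Prop :=
  [transitive permutation_group, on [set: X] | 'P] /\
  forall x : X, 'C_permutation_group[x | 'P]%g = 1%g.

Definition dot (x y : X) : X := (sigma_perm x)^-1%g y.

(* [Omega n] is the map Omega_(n+1) of Dehornoy's calculus, with n + 1
   arguments x_1, ..., x_(n+1) stored at the indices 0, ..., n.  In the
   recursive case [lift ord_max] skips the last argument (index n'+1) and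
   [lift (inord n')] the last but one. *)
Fixpoint Omega (n : nat) : ('I_n.+1 -> X) -> X :=
  match n with
  | 0 => fun u => u ord0
  | n'.+1 => fun u => dot (Omega (fun i => u (lift ord_max i)))
                          (Omega (fun i => u (lift (inord n') i)))
  end.

(* Omega_(d+1)(x, ..., x, y) = y, with d copies of x. *)
Definition dehornoy_condition (d : nat) : Prop :=
  forall x y : X,
    Omega (fun i : 'I_d.+1 => if i == ord_max then y else x) = y.

Definition is_dehornoy_class (d : nat) : Prop :=
  [/\ 0 < d, dehornoy_condition d
    & forall e, 0 < e -> dehornoy_condition e -> d <= e].

Lemma is_dehornoy_class_uniq (d e : nat) :
  is_dehornoy_class d -> is_dehornoy_class e -> d = e.
Proof.
move=> [d0 cd md] [e0 ce me]; apply/eqP; rewrite eqn_leq.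
by rewrite md // me.
Qed.

End Solutions.

(* Main.v *)
Require Import Defs.
From mathcomp Require Import all_boot all_fingroup.
From mathcomp Require Import cyclic.

(** The permutation group [G] of a solution carries a second, abelian group
    law, and Dehornoy's condition says that its exponent divides [d].  Unfolding
    [Omega], the condition for [d] at [x] reads
    [sigma_x o sigma_(Tx) o ... o sigma_(T^(d-1) x) = id], with [T x = x . x];
    the left-hand side is the [d]-fold multiple of [sigma_x] for the addition
    [g + sigma_x = g o sigma_(g^-1 x)] of the left brace [G].

    Instead of constructing this addition, the proof uses its translations.
    On inverses, translation by [sigma_x] is the map [transl x] sending [p] to
    [p] followed by [sigma_(p x)^-1].
    - The translations commute ([translC]): this is the identity
      [(x . y) . (x . z) = (y . x) . (y . z)], which encodes the braid equation.
    - They are injective ([transl_inj]), because [T] is.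
    - They generate an abelian group whose orbit of [1] is [G]
      ([orbit_translations]), since [transl x] is right multiplication by
      [sigma_y^-1] at [p] as soon as [p x = y].
    In an abelian group the stabiliser of [1] is normal of index [#|G|], so the
    [#|G|]-th power of every translation fixes [1].  Hence [d = #|G|] satisfies
    Dehornoy's condition for every finite solution, and a regular action
    forces [#|G| = #|X|]. *)

Set Implicit Arguments.
Unset Strict Implicit.
Unset Printing Implicit Defensive.

Import GroupScope.

Section AdditiveTranslations.

Variables (X : finType) (r : solution X).

Local Notation s := (sigma_perm r).
Local Notation G := (permutation_group r).
Local Notation "x \cdot y" := (dot r x y) (at level 40).

Lemma sigma_dot x y : sigma r x (x \cdot y) = y.
Proof. by have := permKV (s x) y; rewrite permE. Qed.

(** Involutivity: [r] maps [(x, x . y)] to [(y, y . x)]. *)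
Lemma tau_dot x y : tau r (x \cdot y) x = y \cdot x.
Proof.
have rE : r (x, x \cdot y) = (y, tau r (x \cdot y) x).
  by rewrite [LHS]surjective_pairing; congr (_, _); apply: sigma_dot.
have := sol_involutive r (x, x \cdot y); rewrite rE => /(congr1 fst) /= syt.
by apply: (@perm_inj _ (s y)); rewrite permE [RHS]permE sigma_dot.
Qed.

(** The first component of the braid equation: at [y = x . w] it becomes
    symmetric in [x] and [w], which is [sigma_perm_dotC]. *)
Lemma sigma_comp x y z :
  sigma r x (sigma r y z) = sigma r (sigma r x y) (sigma r (tau r y x) z).
Proof.
have := congr1 (fun t => t.1.1) (sol_braid r (x, y, z)).
rewrite /sigma /tau /=; case: (r (x, y)) => a b /=; case: (r (y, z)) => c d /=.
by case: (r (b, z)) => e f /=; case: (r (x, c)) => g h /=.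
Qed.

Lemma sigma_perm_dotC x y : s (x \cdot y) * s x = s (y \cdot x) * s y.
Proof.
by apply/permP => z; rewrite !permM !permE sigma_comp sigma_dot tau_dot.
Qed.

(** [T a = t] forces [tau_t a = t], and [tau_t] is injective. *)
Lemma dot_diag_inj : injective (fun x => x \cdot x).
Proof.
move=> x y Txy; apply: (bij_inj ((sol_nondegenerate r).2 (x \cdot x))).
by rewrite {2}Txy !tau_dot.
Qed.

(** Translation by [sigma_x] in the brace [G], transported along inversion:
    [p] stands for the element [p^-1] of the brace. *)
Definition transl x (p : {perm X}) : {perm X} := p * (s (p x))^-1.

Lemma translE x p y : transl x p y = p x \cdot p y.
Proof. by rewrite permM. Qed.

Lemma translC x y p : transl x (transl y p) = transl y (transl x p).
Proof.
rewrite {1}/transl {3}/transl !translE /transl -!mulgA -!invMg.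
by rewrite sigma_perm_dotC.
Qed.

(** The image [q] of [p] determines [p x], since [q x = T (p x)], and then
    [p = q * s (p x)]. *)
Lemma transl_inj x : injective (transl x).
Proof.
move=> p q pq; have /dot_diag_inj pqx : p x \cdot p x = q x \cdot q x.
  by rewrite -!translE pq.
by move: pq; rewrite /transl pqx => /mulIg.
Qed.

Definition transl_perm x : {perm {perm X}} := perm (@transl_inj x).

Definition translations : {group {perm {perm X}}} :=
  <<[set transl_perm x | x : X]>>%G.

Lemma mem_translations x : transl_perm x \in translations.
Proof. by apply: mem_gen; apply: imset_f. Qed.

Lemma abelian_translations : abelian translations.
Proof.
rewrite abelian_gen; apply/centsP => _ /imsetP[x _ ->] _ /imsetP[y _ ->].
by apply/permP => p; rewrite !permM !permE translC.
Qed.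

Lemma mem_sigma_perm x : s x \in G.
Proof. by apply: mem_gen; apply: imset_f. Qed.

Lemma orbit_translations : orbit 'P translations 1 = G.
Proof.
apply/eqP; rewrite eqEsubset; apply/andP; split.
  have sub_stab : translations \subset 'N(G | 'P).
    rewrite gen_subG; apply/subsetP => _ /imsetP[x _ ->].
    rewrite inE in_setT inE; apply/subsetP => p Gp.
    by rewrite inE /= apermE permE groupM // groupV mem_sigma_perm.
  by rewrite acts_sub_orbit ?group1.
set O := orbit _ _ _.
have O1 : 1 \in O by apply: orbit_refl.
have O_mulr y p : p \in O -> p * (s y)^-1 \in O.
  (* The translation that multiplies [p] by [sigma_y^-1] depends on [p]. *)
  move=> Op; rewrite -(permKV p y) -/(transl _ p).
  rewrite (_ : transl _ p = 'P%act p (transl_perm (p^-1 y))).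
    exact: orbit_trans (mem_orbit _ _ (mem_translations _)) Op.
  by rewrite /= apermE [RHS]permE.
have sub_stab : G \subset 'N(O | 'R).
  rewrite gen_subG; apply/subsetP => _ /imsetP[y _ ->].
  rewrite -groupV inE in_setT inE; apply/subsetP => p Op.
  by rewrite inE /= O_mulr.
apply/subsetP => g Gg; rewrite -(mul1g g).
by rewrite -[_ * _]/('R%act 1 g) (astabs_act _ (subsetP sub_stab g Gg)).
Qed.

(** The stabiliser [S] of [1] is normal, the translations being commutative, and
    the quotient by [S] has the cardinality of the orbit of [1], namely [#|G|]. *)
Lemma transl_perm_expG x : (transl_perm x ^+ #|G|) 1 = 1.
Proof.
pose S := 'C_translations[1 | 'P].
have index_S : #|translations : S| = #|G|.
  by rewrite -orbit_translations card_orbit.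
have nsS : S <| translations.
  by rewrite -sub_abelian_normal ?subsetIl ?abelian_translations.
have Nx : transl_perm x \in 'N(S).
  exact: subsetP (normal_norm nsS) _ (mem_translations x).
have : transl_perm x ^+ #|G| \in S.
  apply: coset_idr; rewrite ?groupX // morphX // -index_S.
  by rewrite -card_quotient ?normal_norm // expg_cardG ?mem_quotient
             ?mem_translations.
by rewrite inE => /andP[_ /astab1P].
Qed.

Lemma eq_Omega n (u v : 'I_n.+1 -> X) : u =1 v -> Omega r u = Omega r v.
Proof.
elim: n u v => [|n IHn] u v uv /=; first exact: uv.
by congr (dot r _ _); apply: IHn => i; apply: uv.
Qed.

(** Both arguments of the outermost product in [Omega] are instances of the
    same statement, with [x] and [y] respectively in last position; so the
    recursion for [Omega] is [translE]. *)
Lemma Omega_transl n x y :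
  Omega r (fun i : 'I_n.+1 => if i == ord_max then y else x)
  = (transl_perm x ^+ n) 1 y.
Proof.
elim: n y => [|n IHn] y /=; first by rewrite expg0 !perm1.
rewrite expgSr permM permE translE -!IHn; congr (dot r _ _).
  apply: eq_Omega => i.
  by rewrite eq_sym (negPf (neq_lift _ _)); case: eqP.
(* Skipping the last but one argument keeps [y] in last position. *)
apply: eq_Omega => i; congr (if _ then _ else _).
rewrite -!val_eqE /= /bump inordK //.
have := ltn_ord i; rewrite ltnS leq_eqVlt => /orP[/eqP-> | lt_in].
  by rewrite leqnn !eqxx.
by rewrite leqNgt lt_in !ltn_eqF // ltnW.
Qed.

Lemma dehornoy_condition_card_permutation_group : dehornoy_condition r #|G|.
Proof. by move=> x y; rewrite Omega_transl transl_perm_expG perm1. Qed.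

Lemma card_permutation_group_uniconnected : uniconnected r -> #|G| = #|X|.
Proof.
case=> trG regG; have /card_gt0P[x _] := sol_nonempty r.
rewrite -(card_orbit_stab 'P G x) regG cards1 muln1.
by rewrite (atransP trG) ?cardsT ?inE.
Qed.

End AdditiveTranslations.

Theorem corollary5p12 (X : finType) (r : solution X) (hr : uniconnected r) :
  exists d : nat, is_dehornoy_class r d /\ d <= #|X|.
Proof.
pose P d := (0 < d) && [forall x, forall y,
  Omega r (fun i : 'I_d.+1 => if i == ord_max then y else x) == y].
have PP d : reflect (0 < d /\ dehornoy_condition r d) (P d).
  apply: (iffP andP) => -[d_gt0 condd]; split=> //.
    by move=> x y; apply/eqP; move/forallP/(_ x)/forallP: condd.
  by apply/forallP => x; apply/forallP => y; apply/eqP.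
have PX : P #|X|.
  apply/PP; split; first exact: sol_nonempty r.
  rewrite -(card_permutation_group_uniconnected hr).
  exact: dehornoy_condition_card_permutation_group.
have [d /PP[d_gt0 condd] d_min] := ex_minnP (ex_intro P _ PX).
exists d; split; last exact: d_min.
by split=> // e e_gt0 conde; apply: d_min; apply/PP.
Qed.
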